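(* There exists a function $f:\mathbb{N}\to\mathbb{N}$ such that for any graph $G$, $\mathrm{vc}(G)\le f(\mathrm{fun}(G))$.
   Context: $\mathbb{N}$ includes $0$. All graphs are finite, simple (undirected, no loops, no multiple edges), with nonempty vertex set. For a graph $G=(V,E)$ let $A(x,y)=1$ if $x,y\in V$ are adjacent and $A(x,y)=0$ otherwise. Functionality: a vertex $y\in V$ is a function of vertices $x_1,\dots,x_k\in V\setminus\{y\}$ if there exists a Boolean function $g:\{0,1\}^k\to\{0,1\}$ such that for every $z\in V\setminus\{y,x_1,\dots,x_k\}$, $A(y,z)=g(A(x_1,z),\dots,A(x_k,z))$. The functionality $\mathrm{fun}(y)$ of $y$ (in $G$) is the minimum $k\ge 0$ such that $y$ is a function of some $k$ vertices. The functionality of the graph is $\mathrm{fun}(G)=\max_H\min_{y\in V(H)}\mathrm{fun}(y)$, where the maximum is over all (nonempty) induced subgraphs $H$ of $G$ and $\mathrm{fun}(y)$ is computed in $H$. VC-dimension: for a set system $(X,S)$, where $S$ is a family of subsets of $X$, a subset $A\subseteq X$ is shattered if for every $B\subseteq A$ there is $C\in S$ with $B=A\cap C$; the VC-dimension of $(X,S)$ is the cardinality of a largest shattered subset of $X$. The VC-dimension $\mathrm{vc}(G)$ of a graph $G=(V,E)$ is the VC-dimension of the set system $(V,S)$, where $S=\{N[v] : v\in V\}$ is the family of closed neighbourhoods, $N[v]=\{v\}\cup N(v)$. *)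

(* Defs.v *)
From mathcomp Require Import all_boot.

Set Implicit Arguments.
Unset Strict Implicit.
Unset Printing Implicit Defensive.

(* Finite simple graphs; nonemptiness is stated separately as [0 < #|G|]. *)
Record sgraph := SGraph {
  vertex :> finType;
  adj : rel vertex;
  adj_sym : symmetric adj;
  adj_irrefl : irreflexive adj }.

Section Induced.
Variables (G : sgraph) (H : {set G}).

Definition induced_adj : rel {x : G | x \in H} :=
  fun x y => adj (val x) (val y).

Lemma induced_adj_sym : symmetric induced_adj.
Proof. by move=> x y; apply: adj_sym. Qed.

Lemma induced_adj_irrefl : irreflexive induced_adj.
Proof. by move=> x; apply: adj_irrefl. Qed.

Definition induced : sgraph := SGraph induced_adj_sym induced_adj_irrefl.

End Induced.

Section Functionality.
Variable G : sgraph.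

Definition is_function_of (y : G) (k : nat) (x : k.-tuple G) : bool :=
  (y \notin x) &&
  [exists g : {ffun k.-tuple bool -> bool},
    [forall z : G, (z != y) ==> (z \notin x) ==>
      (adj y z == g [tuple of [seq adj xi z | xi <- x]])]].

Definition function_of_some (y : G) (k : nat) : bool :=
  [exists x : k.-tuple G, is_function_of y x].

Lemma function_of_others (y : G) : function_of_some y #|G|.-1.
Proof.
have sz : size (enum (predC1 y)) == #|G|.-1 by rewrite -cardE (cardC1 y).
apply/existsP; exists (Tuple sz); apply/andP; split.
  by rewrite memtE /= mem_enum !inE eqxx.
apply/existsP; exists [ffun=> false]; apply/forallP => z.
apply/implyP => zy; apply/implyP.
by rewrite memtE /= mem_enum !inE zy.
Qed.

Lemma ex_function_of_some (y : G) : exists k, function_of_some y k.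
Proof. by exists #|G|.-1; apply: function_of_others. Qed.

Definition vfun (y : G) : nat := ex_minn (ex_function_of_some y).

Lemma vfun_lt (y : G) : vfun y < #|G|.
Proof.
rewrite /vfun; case: ex_minnP => k _ /(_ _ (function_of_others y)) le_k.
have G0 : 0 < #|G| by apply/card_gt0P; exists y.
by rewrite -(prednK G0) ltnS.
Qed.

(* On a nonempty graph this is the true minimum: by [vfun_lt], the default
   value #|G| exceeds every [vfun y]. *)
Definition min_vfun : nat := \big[minn/#|G|]_(y : G) vfun y.

End Functionality.

Definition functionality (G : sgraph) : nat :=
  \max_(H : {set G} | H != set0) min_vfun (induced H).

Section VCDimension.
Variable T : finType.

Definition shattered (S : {set {set T}}) (A : {set T}) : bool :=
  [forall (B : {set T} | B \subset A), [exists C in S, B == A :&: C]].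

Definition vc_dim (S : {set {set T}}) : nat :=
  \max_(A : {set T} | shattered S A) #|A|.

End VCDimension.

Definition closed_nbhd (G : sgraph) (v : G) : {set G} :=
  v |: [set w | adj v w].

Definition vc (G : sgraph) : nat := vc_dim [set closed_nbhd v | v : G].

(* Main.v *)
(** A graph all of whose induced subgraphs have a vertex that is a function of
    at most [k] others can be rebuilt one vertex at a time, each new vertex
    costing one of [2 ^ O(log n)] choices, so it has only [2 ^ O(n log n)]
    labelled induced subgraphs on [n] vertices. A shattered set of size [n],
    together with arbitrary [n]-tuples of vertices realising prescribed traces
    on it, yields [2 ^ (n * n)] of them on [2 * n] labels. Hence [n] is bounded
    in terms of [k]. *)
Require Import Defs.
From mathcomp Require Import all_boot.

Set Implicit Arguments.
Unset Strict Implicit.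
Unset Printing Implicit Defensive.

Section Patterns.
Variable G : sgraph.

(** Membership in closed neighbourhoods: the reflexive form makes traces of [closed_nbhd] readable
    from a pattern even when labels repeat a vertex. *)
Definition cadj (u v : G) : bool := (u == v) || adj u v.

Lemma cadj_sym : symmetric cadj.
Proof. by move=> u v; rewrite /cadj eq_sym adj_sym. Qed.

(* Labellings need not be injective: a vertex of a realising tuple may lie in
   the shattered set or be repeated. *)
Definition pattern m (w : 'I_m -> G) : {ffun 'I_m * 'I_m -> bool} :=
  [ffun p => cadj (w p.1) (w p.2)].

Definition patterns m : {set {ffun 'I_m * 'I_m -> bool}} :=
  [set pattern w | w : {ffun 'I_m -> G}].

Lemma pattern_in m (w : 'I_m -> G) : pattern w \in patterns m.
Proof.
apply/imsetP; exists (finfun w) => //.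
by apply/ffunP=> p; rewrite !ffunE.
Qed.

End Patterns.

Section Peeling.
Variables K m : nat.
Implicit Types (x : {ffun 'I_K -> option 'I_m}) (M : {ffun 'I_m * 'I_m -> bool}).

(* Recording whether [j] is one of the [x t] lets the Boolean function on
   profiles also give the adjacency to the [x t] themselves. *)
Definition profile x M (j : 'I_m) : {ffun 'I_K -> bool * bool} :=
  [ffun t => if x t is Some a then (a == j, M (a, j)) else (false, false)].

Definition extension_code : finType :=
  ('I_m.+1 * {ffun 'I_K -> option 'I_m}
   * {ffun {ffun 'I_K -> bool * bool} -> bool})%type.

Definition extend (c : extension_code) M : {ffun 'I_m.+1 * 'I_m.+1 -> bool} :=
  let: (i, x, g) := c in
  [ffun p => match unlift i p.1, unlift i p.2 with
             | Some a, Some b => M (a, b)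
             | Some a, None | None, Some a => g (profile x M a)
             | None, None => true
             end].

Lemma card_extension_code :
  #|extension_code| = m.+1 ^ K.+1 * 2 ^ (4 ^ K).
Proof.
by rewrite !card_prod !card_ffun card_option card_prod !card_bool !card_ord expnS.
Qed.

Lemma pattern_extend (G : sgraph) (w : 'I_m.+1 -> G) i x :
  (forall j j', let M := pattern (w \o lift i) in
     profile x M j = profile x M j' ->
     cadj (w i) (w (lift i j)) = cadj (w i) (w (lift i j'))) ->
  exists c, pattern w = extend c (pattern (w \o lift i)).
Proof.
set M := pattern _ => /= prof.
(* The existential makes [g] total; [prof] guarantees that any witness [j] of a profile gives the
   same value. *)
pose g := [ffun p => [exists j, (profile x M j == p) && cadj (w i) (w (lift i j))]].
have gE j : g (profile x M j) = cadj (w i) (w (lift i j)).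
  rewrite ffunE; apply/existsP/idP => [[j' /andP[/eqP/prof <-]]//|wj].
  by exists j; rewrite eqxx.
exists (i, x, g); apply/ffunP => -[a b]; rewrite [LHS]ffunE [RHS]ffunE /=.
case: (unliftP i a) => [a' ->|->]; case: (unliftP i b) => [b' ->|->].
- by rewrite ffunE.
- by rewrite gE cadj_sym.
- by rewrite gE.
- by rewrite /cadj eqxx.
Qed.

End Peeling.

Lemma ex_vfun_le_min (G : sgraph) :
  0 < #|G| -> exists y : G, vfun y <= min_vfun G.
Proof.
case/card_gt0P=> y0 _; apply/existsP; apply: contraT; rewrite negb_exists.
move=> /forallP gt_min; have: min_vfun G < min_vfun G; last by rewrite ltnn.
(* If every [vfun] exceeded the minimum, so would the default [#|G|], which lies above [vfun y0]. *)
rewrite {2}/min_vfun; elim/big_ind: _ => [|p q lt_p lt_q|y _].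
- by apply: ltn_trans (vfun_lt y0); rewrite ltnNge.
- by rewrite leq_min lt_p.
- by rewrite ltnNge.
Qed.

Lemma ex_vfun_le_functionality (G : sgraph) (H : {set G}) :
  H != set0 -> exists y : induced H, vfun y <= functionality G.
Proof.
move=> H0; have [|y le_y] := @ex_vfun_le_min (induced H).
  by rewrite card_sig; have /set0Pn[v vH] := H0; apply/card_gt0P; exists v.
exists y; apply: leq_trans le_y _.
exact: (@leq_bigmax_cond _ _ (fun H => min_vfun (induced H))).
Qed.

Lemma vfunP (G : sgraph) (y : G) :
  exists x : (vfun y).-tuple G, is_function_of y x.
Proof. by apply/existsP; rewrite /vfun; case: ex_minnP. Qed.

Lemma is_function_of_eq (G : sgraph) (y : G) k (x : k.-tuple G) (z z' : G) :
  is_function_of y x -> z != y -> z' != y -> z \notin x -> z' \notin x ->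
  {in x, forall u, adj u z = adj u z'} -> adj y z = adj y z'.
Proof.
case/andP=> _ /existsP[g /forallP gP] zy z'y zx z'x eq_x.
have /implyP/(_ zy)/implyP/(_ zx)/eqP -> := gP z.
have /implyP/(_ z'y)/implyP/(_ z'x)/eqP -> := gP z'.
by congr (g _); apply/val_inj/eq_in_map.
Qed.

(** If two labels share a vertex, one is dropped and recovered as a copy of the other; the successor
    on [functionality G] ensures a slot for this. Otherwise the image of [w] induces a subgraph with
    a vertex of small functionality, whose label is dropped. *)
Lemma pattern_peel (G : sgraph) m (w : 'I_m.+1 -> G) :
  exists i (c : extension_code (functionality G).+1 m),
    pattern w = extend c (pattern (w \o lift i)).
Proof.
have [/injectiveP w_inj|] := boolP (injectiveb w); last first.
  case/injectivePn=> i [i' ii' wE]; exists i.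
  have [a i'E _] := unlift_some ii'.
  apply: (@pattern_extend _ _ _ _ _ [ffun=> Some a]) => j j' /= /ffunP/(_ ord0).
  by rewrite !ffunE /= -i'E -wE => -[].
pose H := [set w i | i : 'I_m.+1].
have wH i : w i \in H by apply: imset_f.
have [|y le_y] := @ex_vfun_le_functionality G H.
  by apply/set0Pn; exists (w ord0).
have [x xP] := vfunP y.
have /imsetP[i _ yE] := valP y; exists i.
pose inv (u : induced H) := [pick a | w (lift i a) == val u].
have invP u : u != y -> exists2 a, inv u = Some a & val u = w (lift i a).
  move=> uy; have /imsetP[i' _ uE] := valP u.
  have ii' : i != i' by apply: contraNneq uy => ii'; apply/eqP/val_inj; rewrite yE ii'.
  have [a aE _] := unlift_some ii'; rewrite /inv; case: pickP => [b /eqP bE|/(_ a)].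
    by exists b.
  by rewrite -aE uE eqxx.
(* Slots past the end of [x] default to [y], whose only label [i] is removed, so [inv] turns them
   into [None]. *)
pose x' : {ffun 'I_(functionality G).+1 -> option 'I_m} :=
  [ffun t => inv (nth y x (nat_of_ord t))].
apply: (@pattern_extend _ _ _ _ _ x') => j j' /= eq_prof.
have [->//|jj'] := eqVneq j j'.
pose z a : induced H := Sub (w (lift i a)) (wH _).
have zy a : z a != y.
  by rewrite -val_eqE /= yE (inj_eq w_inj) eq_sym neq_lift.
have cadjE a b : a != b -> cadj (w (lift i a)) (w (lift i b)) = adj (z a) (z b).
  by move=> ab; rewrite /cadj (inj_eq w_inj) (inj_eq lift_inj) (negPf ab).
have cadjyE a : cadj (w i) (w (lift i a)) = adj y (z a).
  by rewrite /cadj (inj_eq w_inj) (negPf (neq_lift _ _)) /= /induced_adj yE.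
(* The equality flags agree at [j] and [j']; as [j] differs from [j'], both are false. Hence [z j]
   and [z j'] avoid [x], where the functional dependence of [y] applies. *)
have x_prof u : u \in x ->
    exists a, [/\ u = z a, a != j, a != j' & adj u (z j) = adj u (z j')].
  move=> ux; have uy : u != y by apply: contraTneq ux => ->; case/andP: xP.
  have [a invE uE] := invP u uy.
  have lt_u : index u x < (functionality G).+1.
    by rewrite ltnS (leq_trans _ le_y) // -{2}(size_tuple x) ltnW // index_mem.
  have /ffunP/(_ (Ordinal lt_u)) := eq_prof.
  rewrite !ffunE /= nth_index // invE => -[eq_a].
  have aj : a != j.
    by apply/negP=> aj; case/negP: jj'; rewrite -(eqP aj) -eq_a.
  have aj' : a != j' by rewrite -eq_a.
  have -> : u = z a by apply: val_inj.
  by rewrite !ffunE /= !cadjE // => eq_adj; exists a.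
have znx a : (a == j) || (a == j') -> z a \notin x.
  move=> aE; apply/negP=> /x_prof[b [/(congr1 val)/= /w_inj/lift_inj ab bj bj' _]].
  by move: aE; rewrite ab (negPf bj) (negPf bj').
rewrite !cadjyE; apply: (is_function_of_eq xP); rewrite ?zy ?znx ?eqxx ?orbT //.
by move=> u /x_prof[a []].
Qed.

Lemma card_patternsS (G : sgraph) m (K := (functionality G).+1) :
  #|patterns G m.+1| <= m.+1 ^ K.+1 * 2 ^ (4 ^ K) * #|patterns G m|.
Proof.
rewrite -card_extension_code -cardsT -cardsX.
apply: leq_trans (leq_imset_card (fun p => extend p.1 p.2) _).
apply/subset_leq_card/subsetP => _ /imsetP[w _ ->].
have [i [c ->]] := pattern_peel w.
by apply/imsetP; exists (c, pattern (w \o lift i)); rewrite // !inE pattern_in.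
Qed.

Lemma card_patterns (G : sgraph) n m (K := (functionality G).+1) :
  m <= n -> #|patterns G m| <= (n ^ K.+1 * 2 ^ (4 ^ K)) ^ m.
Proof.
elim: m => [|m IHm] le_mn.
  apply: leq_trans (max_card _) _.
  by rewrite card_ffun card_prod !card_ord.
apply: leq_trans (card_patternsS G m) _; rewrite [leqRHS]expnS.
apply: leq_mul; last exact: IHm (ltnW le_mn).
by rewrite leq_mul2r leq_exp2r // le_mn orbT.
Qed.

(** The last [#|A|] labels enumerate [A] and the first ones realise prescribed traces, so every
    Boolean matrix occurs as an off-diagonal block of a pattern. *)
Lemma shattered_card_patterns (G : sgraph) (A : {set G}) :
  shattered [set closed_nbhd v | v : G] A ->
  2 ^ (#|A| * #|A|) <= #|patterns G (#|A| + #|A|)|.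
Proof.
move=> /forallP shA; set n := #|A|.
pose block (M : {ffun 'I_(n + n) * 'I_(n + n) -> bool}) :=
  [ffun p : 'I_n * 'I_n => M (lshift n p.1, rshift n p.2)].
have -> : 2 ^ (n * n) = #|{ffun 'I_n * 'I_n -> bool}|.
  by rewrite card_ffun card_prod card_bool !card_ord.
rewrite -cardsT; apply: leq_trans (leq_imset_card block _).
apply/subset_leq_card/subsetP => B _.
have trace i : exists v : G, [forall j, (enum_val j \in closed_nbhd v) == B (i, j)].
  pose Bi := [set enum_val j | j : 'I_n & B (i, j)].
  have /implyP/(_ _)/exists_inP[|_ /imsetP[v _ ->] /eqP BiE] := shA Bi.
    by apply/subsetP=> _ /imsetP[j _ ->]; apply: enum_valP.
  exists v; apply/forallP=> j; have := enum_valP j => /= jA.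
  have : (enum_val j \in Bi) = (enum_val j \in A :&: closed_nbhd v) by rewrite BiE.
  by rewrite inE jA mem_imset ?inE => [->//|]; apply: enum_val_inj.
have [v vP] := fin_all_exists trace.
pose w (s : 'I_(n + n)) := match split s with inl i => v i | inr j => enum_val j end.
apply/imsetP; exists (pattern w); first exact: pattern_in.
apply/ffunP=> -[i j]; have /forallP/(_ j)/eqP <- := vP i.
rewrite !ffunE /w /= -[lshift n i]/(unsplit (inl _ i)) -[rshift n j]/(unsplit (inr _ j)).
by rewrite !unsplitK !inE /cadj eq_sym.
Qed.

(** With [q = n %/ D.*2], the left side is at least [2 ^ (q * D)] squared, while [n.*2 ^ D] is at
    most [2 ^ (q * D) * D.*2.*2 ^ D]. Cancelling one factor bounds [q * D], hence [n]. *)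
Lemma exp2_le_poly_bound D Q n :
  0 < D -> 2 ^ n <= Q * n.*2 ^ D ->
  n <= (Q * D.*2.*2 ^ D + D).*2.
Proof.
move=> D0 le_n; set R := Q * _; set q := n %/ D.*2.
have DD0 : 0 < D.*2 by rewrite double_gt0.
have lt_n : n < q.+1 * D.*2 by apply: ltn_ceil.
have le_q : (q * D).*2 <= n by rewrite doubleMr leq_divM.
have n_exp : n.*2 <= 2 ^ q * D.*2.*2.
  rewrite -doubleMr leq_double (leq_trans (ltnW lt_n)) //.
  by rewrite leq_mul2r ltn_expl ?orbT.
have : 2 ^ (q * D) <= R.
  rewrite -(leq_pmul2r (expn_gt0 2 (q * D))) -expnD addnn.
  apply: leq_trans (leq_trans (leq_pexp2l _ le_q) le_n) _ => //.
  rewrite /R -mulnA leq_mul2l [_ * 2 ^ _]mulnC expnM -expnMn leq_exp2r //.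
  by rewrite n_exp orbT.
move/(leq_trans (ltnW (ltn_expl _ (ltnSn 1)))) => le_R.
rewrite (leq_trans (ltnW lt_n)) // -doubleMr leq_double mulSn addnC.
by rewrite leq_add2r.
Qed.

Definition vc_bound (k : nat) : nat :=
  let D := k.+2.*2 in
  (2 ^ (4 ^ k.+1).*2 * D.*2.*2 ^ D + D).*2.

Theorem theorem8 :
  exists f : nat -> nat,
    forall G : sgraph, 0 < #|G| -> vc G <= f (functionality G).
Proof.
exists vc_bound => G _; apply/bigmax_leqP => A shA.
have := leq_trans (shattered_card_patterns shA) (card_patterns G (leqnn _)).
set n := #|A|; case: (posnP n) => [->//|n0]; rewrite addnn.
(* Taking [n]-th roots leaves [2 ^ n] below the square of the one-step factor at [n.*2]; squaring
   accounts for the doublings in [vc_bound] of [k.+2] and of the exponent [4 ^ k.+1]. *)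
rewrite -[X in _ <= _ ^ X]mul2n !expnM leq_exp2r // => le_n.
apply: exp2_le_poly_bound => //.
by rewrite -!muln2 !expnM -expnMn mulnC muln2.
Qed.
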